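(* There exist universal constants $C,c,c_0,C'>0$ such that the following holds. Let $n\ge5$, let $Q\subset\mathbb{R}^n$ be an unconditional convex body, and let $R,r>0$ with $R\ge Cr$. Then there exists a convex body $K\subset\mathbb{R}^n$ that contains a translate of $rQ$ and is contained in a translate of $RQ$, such that: (1) there is a Borel set $S\subset K$ with $c_0\le\operatorname{vol}(S)/\operatorname{vol}(K)\le 1/2$ and $$\frac{\operatorname{vol}(\partial_0^KS)}{\operatorname{vol}(S)}\le\frac{C'r}{nR};$$ (2) for every $0<s<e^{-cn}$ there is a Borel set $S'\subset K$ with $\operatorname{vol}(S')/\operatorname{vol}(K)=s$ and $$\frac{\operatorname{vol}(\partial_0^KS')}{\operatorname{vol}(S')}\le\frac{C'r}{R}.$$
   Context: A convex body is a compact convex set with nonempty interior; $Q$ is unconditional if it is invariant under arbitrary sign changes of the coordinates. For Borel $S\subset K$, the $\ell_0$ boundary $\partial_0^KS$ is the set of $y\in K\setminus S$ for which some $x\in S$ differs from $y$ in at most one coordinate. *)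

(* Defs.v *)
From HB Require Import structures.
From mathcomp Require Import all_boot all_order all_algebra.
From mathcomp Require Import all_classical all_reals all_analysis.

Set Implicit Arguments.
Unset Strict Implicit.
Unset Printing Implicit Defensive.

Import Order.TTheory GRing.Theory Num.Theory.
Import numFieldNormedType.Exports.

Local Open Scope classical_set_scope.
Local Open Scope ring_scope.

(* n-dimensional Lebesgue measure, as the n-fold product of the library's
   one-dimensional one; it lives on n.-tuple R, which carries the product
   sigma-algebra. *)
Section lebesgue_tuple.
Variable R : realType.
Local Open Scope ereal_scope.

Local Notation Rn n := (n.-tuple (measurableTypeR R)).

Definition tcons n (p : measurableTypeR R * Rn n) : Rn n.+1 :=
  [the n.+1.-tuple _ of p.1 :: p.2].

Definition tuncons n (t : Rn n.+1) : measurableTypeR R * Rn n :=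
  (thead t, [tuple of behead t]).

Lemma measurable_tcons n : measurable_fun setT (@tcons n).
Proof. exact: measurable_cons. Qed.

Lemma measurable_tuncons n : measurable_fun setT (@tuncons n).
Proof.
apply/measurable_fun_pairP; split; first exact: measurable_tnth.
exact: measurable_behead.
Qed.

Lemma tconsK n : cancel (@tcons n) (@tuncons n).
Proof. by case=> x t; congr pair; apply/val_inj. Qed.

Lemma tunconsK n : cancel (@tuncons n) (@tcons n).
Proof. by move=> t; rewrite [RHS]tuple_eta; apply/val_inj. Qed.

Section step.
Variables (n : nat) (m : {sigma_finite_measure set (Rn n) -> \bar R}).

Definition lebesgue_cons : set (Rn n.+1) -> \bar R :=
  pushforward (@lebesgue_measure R \x m) (@tcons n).

Let lebesgue_cons0 : lebesgue_cons set0 = 0.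
Proof. by rewrite /lebesgue_cons /pushforward preimage_set0 measure0. Qed.

Let lebesgue_cons_ge0 A : 0 <= lebesgue_cons A.
Proof. by rewrite /lebesgue_cons /pushforward measure_ge0. Qed.

Let lebesgue_cons_sigma_additive : semi_sigma_additive lebesgue_cons.
Proof.
by apply: measure_semi_sigma_additive; exact: measurable_tcons.
Qed.

HB.instance Definition _ := isMeasure.Build _ _ _ lebesgue_cons
  lebesgue_cons0 lebesgue_cons_ge0 lebesgue_cons_sigma_additive.

Let lebesgue_cons_sigma_finite : sigma_finite setT lebesgue_cons.
Proof.
have /sigma_finiteP[F [TF ndF Foo]] := sigma_finiteT (@lebesgue_measure R).
have /sigma_finiteP[G [TG ndG Goo]] := sigma_finiteT m.
exists (fun k => @tuncons n @^-1` (F k `*` G k)).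
  apply/esym; rewrite -subTset => t _.
  have [i _ Fi] : (\bigcup_k F k) (tuncons t).1 by rewrite -TF.
  have [j _ Gj] : (\bigcup_k G k) (tuncons t).2 by rewrite -TG.
  exists (maxn i j) => //; split.
  - by move: Fi; exact/subsetPset/ndF/leq_maxl.
  - by move: Gj; exact/subsetPset/ndG/leq_maxr.
move=> k; have [mF Fk] := Foo k; have [mG Gk] := Goo k; split.
  rewrite -[X in measurable X]setTI; apply: measurable_tuncons => //.
  exact: measurableX.
rewrite /lebesgue_cons /pushforward -comp_preimage.
rewrite (_ : _ \o _ = id); last by apply/funext => p /=; rewrite tconsK.
by rewrite preimage_id product_measure1E// lte_mul_pinfty// ge0_fin_numE.
Qed.

HB.instance Definition _ := Measure_isSigmaFinite.Build _ _ _ lebesgue_cons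
  lebesgue_cons_sigma_finite.

End step.

Fixpoint lebesgue_tuple n : {sigma_finite_measure set (Rn n) -> \bar R} :=
  match n with
  | 0%N => \d_([tuple] : Rn 0)
  | k.+1 => lebesgue_cons (lebesgue_tuple k)
  end.

Lemma measurable_tuple_box n (A : 'I_n -> set (measurableTypeR R)) :
  (forall i, measurable (A i)) ->
  measurable [set t : Rn n | forall i, A i (tnth t i)].
Proof.
move=> mA; rewrite (_ : mkset _ = \bigcap_(i in [set: 'I_n])
    ((fun t : Rn n => tnth t i) @^-1` A i)).
  apply: fin_bigcap_measurable => // i _; rewrite -[X in measurable X]setTI.
  exact: measurable_tnth.
by apply/seteqP; split => t /= At i; [move=> _|]; exact: At.
Qed.

Lemma lebesgue_tuple_box n (A : 'I_n -> set (measurableTypeR R)) :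
  (forall i, measurable (A i)) ->
  lebesgue_tuple n [set t | forall i, A i (tnth t i)] =
  \big[*%E/1]_(i < n) @lebesgue_measure R (A i).
Proof.
elim: n A => [|n IHn] A mA.
  by rewrite big_ord0 /= diracE mem_set // => -[].
rewrite big_ord_recl -IHn; last by move=> i; exact: mA.
rewrite /= /lebesgue_cons /pushforward -product_measure1E //; last first.
  by apply: (@measurable_tuple_box n (fun i => A (lift ord0 i))).
congr ((_ \x _) _); apply/seteqP; split => -[x t] /=.
  by move=> At; split => [|i]; [have := At ord0|have := At (lift ord0 i)];
    rewrite /tcons /= ?tnth0 ?tnthS.
move=> [Ax At] i; case: (unliftP ord0 i) => [j|] ->; rewrite /tcons /=.
  by rewrite tnthS; exact: At.
by rewrite tnth0.
Qed.

End lebesgue_tuple.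

Section euclidean.
Variables (R : realType) (n : nat).
Implicit Types (x y : 'rV[R]_n) (A K Q S : set 'rV[R]_n).

Definition borel A : Prop := <<s @open 'rV[R]_n >> A.

(* Lebesgue (outer) measure on R^n. The outer measure is taken because the
   boundary of a Borel set defined below is a union of projections of Borel
   sets: it is Lebesgue measurable but need not be Borel. *)
Definition vol A : \bar R :=
  ((lebesgue_tuple R n)^* [set t | A (\row_i tnth t i)])%mu.

Lemma vol_box (A : 'I_n -> set (measurableTypeR R)) :
  (forall i, measurable (A i)) ->
  vol [set x | forall i, A i (x ord0 i)] =
  \big[*%E/1%E]_(i < n) @lebesgue_measure R (A i).
Proof.
move=> mA; rewrite /vol -lebesgue_tuple_box // -measurable_mu_extE /=.
  by congr (mu_ext _ _); apply/seteqP; split => t /= At i;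
    have := At i; rewrite mxE.
exact: measurable_tuple_box.
Qed.

Definition convex_body K : Prop :=
  [/\ compact K, convex_set K & K° !=set0].

Definition flip_signs (e : 'I_n -> bool) x : 'rV[R]_n :=
  \row_i ((-1) ^+ e i * x ord0 i).

Definition unconditional Q : Prop :=
  forall e : 'I_n -> bool, flip_signs e @` Q = Q.

(* v + r Q *)
Definition homothet (v : 'rV[R]_n) (r : R) Q : set 'rV[R]_n :=
  [set v + r *: x | x in Q].

Definition l0_boundary K S : set 'rV[R]_n :=
  [set y | (K `\` S) y /\
    exists2 x, S x & (#|[pred i | x ord0 i != y ord0 i]| <= 1)%N].

End euclidean.

(* Main.v *)
(* Let u maximize the product of the coordinates over Q. Then sum_i |q_i / u_i| <= n
   for all q in Q. The body K is a thin neighbourhood of the segment [0, 5b u], of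
   cross-section r Q for t >= b and shrinking linearly to the apex 0 for t <= b, where
   b = rho / 5.

   Cutting K by a hyperplane is not good enough: points of Q may have a few large
   coordinates, so that a move in one coordinate shifts the height by too much. The cut
   is instead [sum_i clip ((x_i / u_i - h) / d) <= 0] where d is a large multiple of the
   width of K at height h and clip truncates to [-1, 1]. One coordinate
   changes this sum by at most 2, hence the boundary of S lies in the layer where the sum
   is in (0, 2]; on average the x_i / u_i are within d / 1000 of the height, so that
   nearly all terms are in the linear range of clip and a shift by O(d / n) along u
   (or, in the cone, a contraction by 1 + O(d / (n h))) maps the layer into S.

   In the cylinder, disjoint translates of the layer in S give the ratio O(r / (n rho)).
   In the cone, the layer lies in (1 + eta) S minus S with n eta = O(r / rho), and the S
   of all heights are homothetic, so that every small volume is attained. *)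
Require Import Defs.
From mathcomp Require Import all_boot all_order all_algebra.
From mathcomp Require Import all_classical all_reals all_analysis.
From mathcomp Require Import ring lra.

Import Order.TTheory GRing.Theory Num.Theory.
Import numFieldNormedType.Exports.

Local Open Scope classical_set_scope.
Local Open Scope ring_scope.

Set Implicit Arguments.
Unset Strict Implicit.
Unset Printing Implicit Defensive.

(** * Sums of truncated deviations *)

Section clip.
Variable R : realFieldType.
Implicit Types (x y : R).

Definition clip x : R := Num.max (-1) (Num.min 1 x).

Lemma clip_le1 x : clip x <= 1.
Proof. by rewrite /clip ge_max ge_min lexx /= andbT; lra. Qed.

Lemma clip_geN1 x : -1 <= clip x.
Proof. by rewrite /clip le_max lexx. Qed.

Lemma clip_mono x y : x <= y -> clip x <= clip y.
Proof.
by move=> xy; rewrite /clip ge_max !le_max lexx /= le_min !ge_min lexx xy /= !orbT.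
Qed.

Lemma clip_id x : -1 <= x -> x <= 1 -> clip x = x.
Proof. by move=> x1 x2; rewrite /clip (min_idPr x2) (max_idPr x1). Qed.

Lemma clip_le_id x : -1 <= x -> clip x <= x.
Proof. by move=> x1; rewrite /clip ge_max x1 ge_min lexx orbT. Qed.

Lemma clip_1 x : 1 <= x -> clip x = 1.
Proof. by move=> x1; rewrite /clip (min_idPl x1); apply/max_idPr; lra. Qed.

Lemma clip_N1 x : x <= -1 -> clip x = -1.
Proof. by move=> x1; rewrite /clip (min_idPr _) ?(max_idPl x1)//; lra. Qed.

Lemma clip_lip x y : clip x - clip y <= `|x - y|.
Proof.
have [xy|yx] := leP x y.
  by apply: le_trans (normr_ge0 _); rewrite subr_le0; exact: clip_mono.
rewrite ger0_norm ?subr_ge0 ?(ltW yx)//.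
have [x1|x1] := leP x (-1); first by rewrite !clip_N1; lra.
have [y1|y1] := leP 1 y; first by rewrite !clip_1; lra.
have := clip_le_id (ltW x1).
have [y2|y2] := leP y (-1); first by rewrite (clip_N1 y2); lra.
by rewrite (clip_id (x := y)); lra.
Qed.

End clip.

Section clip_sum.
Variables (R : realFieldType) (n : nat) (tau : R) (p w : 'I_n -> R).
Hypothesis n5 : (5 <= n)%N.
Hypothesis p_small : \sum_i `|p i| <= n%:R / 1000.
Hypothesis wE : forall i, w i = tau + p i.

Let n5R : 5 <= n%:R :> R. Proof. by rewrite ler_nat. Qed.

Let sum_const (x : R) : \sum_(i < n) x = n%:R * x.
Proof. by rewrite sumr_const card_ord mulr_natl. Qed.

(** Since [clip] is 1-Lipschitz, [clip tau] exceeds the average of the [clip (w i)] by at most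
    1/1000. As n >= 5, this average is at most 2/5, which leaves [clip tau] below the truncation
    value 1. *)
Lemma clip_sum_le2 : \sum_i clip (w i) <= 2 -> tau <= 401 / 1000.
Proof.
move=> H; have : \sum_i (clip tau - `|p i|) <= \sum_i clip (w i).
  apply: ler_sum => i _; have := clip_lip tau (w i).
  by rewrite wE opprD addNKr normrN; lra.
rewrite sumrB sum_const => H'; move: n5R p_small H'; set N := n%:R => N5 ps H'.
have {}H' : N * (clip tau - 1 / 1000) <= 2 by lra.
have : clip tau <= 401 / 1000 by nra.
have [t1|t1] := leP 1 tau; first by rewrite clip_1//; lra.
have [t2|t2] := leP tau (-1); first by lra.
by rewrite clip_id; lra.
Qed.

Lemma clip_sum_gt0 : 0 < \sum_i clip (w i) -> - (1 / 1000) < tau.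
Proof.
move=> H; have : \sum_i clip (w i) <= \sum_i (clip tau + `|p i|).
  apply: ler_sum => i _; have := clip_lip (w i) tau.
  by rewrite wE addrAC subrr add0r; lra.
rewrite big_split /= sum_const => H'; move: n5R p_small H'; set N := n%:R => N5 ps H'.
have {}H' : 0 < N * (clip tau + 1 / 1000) by lra.
have : - (1 / 1000) < clip tau by nra.
have [t1|t1] := leP 1 tau; first by lra.
have [t2|t2] := leP tau (-1); first by rewrite clip_N1//; lra.
by rewrite clip_id; lra.
Qed.

(* Since the [p i] are small on average, nearly all the [w i] are in the range where
   [clip] is the identity; lowering those by [21 / (10 n)] lowers the sum by more
   than 2. *)
Lemma clip_sum_drop (w' : 'I_n -> R) :
  0 < \sum_i clip (w i) -> \sum_i clip (w i) <= 2 ->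
  (forall i, clip (w' i) <= clip (w i)) ->
  (forall i, `|p i| <= 1 / 10 -> w' i <= w i - 21 / 10 / n%:R) ->
  \sum_i clip (w' i) <= 0.
Proof.
move=> s0 s2 w'w w'd.
have t1 := clip_sum_gt0 s0; have t2 := clip_sum_le2 s2.
set k := 21 / 10 / n%:R in w'd.
have n5' := n5R.
have n0 : (0 : R) < n%:R by lra.
have kn : k * n%:R = 21 / 10 by rewrite /k mulfVK// gt_eqF.
have k0 : 0 < k by rewrite /k divr_gt0//; lra.
have k1 : k <= 42 / 100 by rewrite /k ler_pdivrMr//; lra.
(* The subtracted terms add up to at least [k * n * (1 - 1/100)] = 2.079 > 2. Where [|p i| > 1/10]
   the subtracted term is negative and [w'w] suffices; elsewhere [clip] is the identity at [w i] and
   the full drop [k] is available. *)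
suff H : \sum_i clip (w' i) <= \sum_i (clip (w i) - k * (1 - 10 * `|p i|)).
  apply: (le_trans H); rewrite sumrB -mulr_sumr sumrB sum_const -mulr_sumr.
  have : k * \sum_i `|p i| <= k * (n%:R / 1000) by rewrite ler_pM2l.
  by lra.
apply: ler_sum => i _.
have [pi|pi] := leP `|p i| (1 / 10); last first.
  have k10 : 0 <= k * (10 * `|p i| - 1) by apply: mulr_ge0; lra.
  by have := w'w i; lra.
have := pi; rewrite ler_norml => /andP[p1 p2].
have := w'd i pi; have := wE i => wi w'i.
rewrite [X in _ <= X - _]clip_id ?wi; [|lra|lra].
have kp : 0 <= k * `|p i| by rewrite mulr_ge0// ltW.
apply: le_trans (clip_mono w'i) _.
by apply: (le_trans (clip_le_id _)); lra.
Qed.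

End clip_sum.

(** * Volume *)

Section affine_tuple.
Variable R : realType.
Local Notation Rn n := (n.-tuple (measurableTypeR R)).

Lemma measurable_affine (c v : R) :
  measurable_fun setT ((fun x => c * x + v) : measurableTypeR R -> measurableTypeR R).
Proof.
by apply: measurable_realfun.measurable_funD => //; apply: measurable_realfun.measurable_funM.
Qed.

Lemma lebesgue_measure_affine (c v : R) (A : set (measurableTypeR R)) :
  0 < c -> measurable A ->
  lebesgue_measure A = (c%:E * @lebesgue_measure R ((fun x : R => (c * x + v)%R) @^-1` A))%E.
Proof.
move=> c0 mA.
pose f : measurableTypeR R -> measurableTypeR R := fun x => c * x + v.
have mf : measurable_fun setT f.
  exact: measurable_affine.
pose mu' : {measure set (measurableTypeR R) -> \bar R} :=
  mscale (NngNum (ltW c0)) (pushforward (@lebesgue_measure R) f).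
rewrite (@lebesgue_measure_unique R (mu' mf) _ A mA)// => X [[a b] /= ab <-].
rewrite /mu' /mscale /= /pushforward /=.
rewrite (_ : f @^-1` _ = `](a - v) / c, (b - v) / c]%classic); last first.
  apply/seteqP; split => x /=; rewrite !in_itv /= /f ltr_pdivrMr// ler_pdivlMr//;
   move=> /andP[h1 h2]; apply/andP; split; lra.
rewrite !lebesgue_measure_itv /= !lte_fin.
rewrite ltr_pM2r ?invr_gt0// ltrD2r; case: ifPn => _; last by rewrite mule0.
rewrite -!EFinB -EFinM; congr EFin; field; exact: lt0r_neq0.
Qed.

Definition tuple_affine n (c : R) (v t : Rn n) : Rn n :=
  [tuple (c * tnth t i + tnth v i : measurableTypeR R) | i < n].

Lemma measurable_tuple_affine n c v : measurable_fun setT (@tuple_affine n c v).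
Proof.
apply/measurable_fun_tnthP => i.
rewrite (_ : _ \o _ = fun t : Rn n => c * tnth t i + tnth v i); last first.
  by apply/funext => t /=; rewrite tnth_mktuple.
apply: measurable_realfun.measurable_funD => //; apply: measurable_realfun.measurable_funM => //.
exact: measurable_tnth.
Qed.

(** Induction on the dimension: the scaled pushforward of the product measure under the affine map
    agrees with the product measure on rectangles, which determine it. The case [c = 1] is
    translation invariance. *)
Lemma lebesgue_tuple_affine n (c : R) (v : Rn n) (A : set (Rn n)) :
  0 < c -> measurable A ->
  lebesgue_tuple R n A =
  ((c ^+ n)%:E * lebesgue_tuple R n (tuple_affine c v @^-1` A))%E.
Proof.
move=> c0; elim: n v A => [|n IHn] v A mA.
  rewrite expr0 mul1e /=; congr (dirac _ _); apply/seteqP.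
  by split => t /=; rewrite (tuple0 t) (tuple0 (tuple_affine _ _ _)).
pose v' : Rn n := [tuple of behead v].
pose g (p : measurableTypeR R * Rn n) : measurableTypeR R * Rn n :=
  (c * p.1 + thead v, tuple_affine c v' p.2).
have mg : measurable_fun setT g.
  apply/measurable_fun_pairP; split.
    apply: measurable_realfun.measurable_funD => //.
    by apply: measurable_realfun.measurable_funM => //; exact: measurable_fst.
  rewrite (_ : _ \o _ = tuple_affine c v' \o snd)//.
  exact: measurableT_comp (@measurable_tuple_affine n c v') measurable_snd.
have tconsE p : tcons (g p) = tuple_affine c v (tcons p).
  apply: eq_from_tnth => i; rewrite tnth_mktuple /tcons /=.
  case: (unliftP ord0 i) => [j|] ->; rewrite ?tnth0 ?tnthS ?tnth_mktuple//.
    by rewrite /v' tnth_behead; congr (_ + tnth v _); apply/val_inj; rewrite /= inordK// ltnS.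
pose m' := mscale (NngNum (ltW (exprn_gt0 n.+1 c0)))
  (pushforward (@lebesgue_measure R \x lebesgue_tuple R n)%E g).
have mA' : measurable (@tcons R n @^-1` A).
  by rewrite -[X in measurable X]setTI; exact: measurable_tcons.
rewrite [LHS]/= /lebesgue_cons {1}/pushforward.
rewrite (@product_measure_unique _ _ _ _ _ _ _ (m' mg) _ _ mA').
  rewrite /m' /mscale /= /lebesgue_cons /pushforward; congr (_ * _)%E.
  congr ((_ \x _)%E _); apply/seteqP.
  by split => p /=; rewrite tconsE.
move=> X Y mX mY.
have mX' : measurable ((fun x : R => c * x + thead v) @^-1` X : set (measurableTypeR R)).
  pose f : measurableTypeR R -> measurableTypeR R := fun x => c * x + thead v.
  have mf : measurable_fun setT f.
    exact: measurable_affine.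
  by rewrite -[X in measurable X]setTI; exact: mf.
have mY' : measurable (tuple_affine c v' @^-1` Y).
  by rewrite -[X in measurable X]setTI; exact: measurable_tuple_affine.
transitivity ((c ^+ n.+1)%:E * (@lebesgue_measure R \x lebesgue_tuple R n)
    (((fun x : R => (c * x + thead v)%R) @^-1` X) `*` (tuple_affine c v' @^-1` Y)))%E; first by [].
have h1 := lebesgue_measure_affine (thead v) c0 mX; have h2 := IHn v' _ mY.
apply: (etrans _ (esym (congr2 (fun x y : \bar R => x * y)%E h1 h2))).
by rewrite product_measure1E// exprS EFinM muleACA.
Qed.

End affine_tuple.

(** * Measurability, packing and scaling for [vol] *)

Section volume.
Variables (R : realType) (n : nat).
Local Notation Rn n := (n.-tuple (measurableTypeR R)).
Implicit Types (A B S : set 'rV[R]_n).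

Definition coords A : set (Rn n) := [set t | A (\row_i tnth t i)].

Definition tuple_of_row (x : 'rV[R]_n) : Rn n :=
  [tuple (x ord0 i : measurableTypeR R) | i < n].

(** An open set is the union of the boxes with rational centre and radius 1/(k+1) that it contains,
    and there are countably many of these. This links the topology of row vectors to the product
    sigma-algebra on tuples. *)
Lemma measurable_coords_open A : open A -> measurable (coords A).
Proof.
move=> oA.
pose box (q : {ffun 'I_n -> rat} * nat) : set 'rV[R]_n :=
  [set x | forall i, ball (ratr (q.1 i) : R) (q.2.+1%:R^-1) (x ord0 i)].
rewrite (_ : coords A = \bigcup_(q in [set q | box q `<=` A]) coords (box q)).
  rewrite bigcup_mkcond; apply: countable_bigcupT_measurable => [|q]; first exact: countableP.
  case: ifP => _; last exact: measurable0.
  rewrite (_ : coords _ = [set t : Rn n | forall i, ball (ratr (q.1 i) : R) q.2.+1%:R^-1 (tnth t i)]).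
    apply: (@measurable_tuple_box R n (fun i => ball (ratr (q.1 i) : R) q.2.+1%:R^-1)) => i.
    exact: measurable_realfun.measurable_ball.
  by apply/seteqP; split => t /= + i => /(_ i); rewrite mxE.
apply/seteqP; split => [t At|t [q qA] qt]; last exact: qA.
have /nbhs_ballP[e /= e0 eA] := open_nbhs_nbhs (conj oA At).
have e2 : 0 < e / 2 by rewrite divr_gt0.
(* With a radius below [e / 2], any two points of the box are closer than [e]. *)
have [k _ ke] : \forall k \near \oo, k.+1%:R^-1 < e / 2.
  exact: (near_infty_natSinv_lt (PosNum e2)).
have ke' := ke k (leqnn _).
have k0 : (0 : R) < k.+1%:R^-1 by rewrite invr_gt0.
have ex (x d : R) : 0 < d -> exists q : rat, ball x d (ratr q).
  move=> d0; have xd : x - d < x + d by lra.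
  have [q] := rat_in_itvoo xd; rewrite in_itv /= => /andP[q1 q2]; exists q.
  by rewrite /ball /= ltr_norml; apply/andP; split; lra.
pose q : {ffun 'I_n -> rat} := [ffun i => projT1 (cid (ex (tnth t i) _ k0))].
have qP i : ball (tnth t i : R) (k.+1%:R^-1) (ratr (q i)).
  by rewrite ffunE; case: cid.
exists (q, k) => /=; last by move=> i; rewrite mxE; apply: ball_sym.
move=> x /= xq; apply: eA; split => // i j; rewrite (ord1 i) mxE.
move: k.+1%:R^-1 ke' (tnth t j : R) (xq j) (qP j) => d de y; rewrite /ball /= !ltr_norml.
by move=> /andP[? ?] /andP[? ?]; apply/andP; split; lra.
Qed.

Lemma measurable_coords_closed A : closed A -> measurable (coords A).
Proof.
rewrite -openC => /measurable_coords_open /measurableC.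
by congr (measurable _); apply/seteqP; split => t /=; rewrite /coords /= /setC /=; [move/contrapT|move=> ? ?].
Qed.

Lemma borel_closed A : closed A -> borel A.
Proof.
move=> cA; rewrite -(setCK A) /borel.
apply: sigma_algebraC; apply: sub_sigma_algebra; exact: closed_openC.
Qed.

Lemma vol_coords A : measurable (coords A) -> vol A = lebesgue_tuple R n (coords A).
Proof. exact: measurable_mu_extE. Qed.

Lemma le_vol A B : A `<=` B -> (vol A <= vol B)%E.
Proof. by move=> AB; apply: le_outer_measure => t; exact: AB. Qed.

Lemma vol_ge0 A : (0 <= vol A)%E.
Proof. exact: outer_measure_ge0. Qed.

Lemma vol_bigcup_le N (F : nat -> set 'rV[R]_n) A :
  (forall x, A x -> exists2 k, (k < N)%N & F k x) ->
  (vol A <= \sum_(k < N) vol (F k))%E.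
Proof.
move=> AF; pose G k := coords (F k).
have := outer_measure_subadditive (mu_ext (lebesgue_tuple R n)) G N.
apply: le_trans; apply: le_outer_measure => t At.
by rewrite -bigcup_mkord; have [k kN Fk] := AF _ At; exists k.
Qed.

(** As [vol] is an outer measure, additivity requires measurable pieces. All packing arguments below
    rest on this bound. *)
Lemma sum_vol_disjoint_le N (F : nat -> set 'rV[R]_n) A :
  (forall k, measurable (coords (F k))) -> measurable (coords A) ->
  (forall k x, (k < N)%N -> F k x -> A x) ->
  (forall i j x, (i < N)%N -> (j < N)%N -> F i x -> F j x -> i = j) ->
  (\sum_(k < N) vol (F k) <= vol A)%E.
Proof.
move=> mF mA FA Fdisj.
pose G k := if (k < N)%N then coords (F k) else set0.
have mG k : measurable (G k) by rewrite /G; case: ifP.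
have tG : trivIset setT G.
  apply/trivIsetP => i j _ _; apply: contra_neqP => /eqP/set0P[t []].
  by rewrite /G; case: ifP => // iN Fi; case: ifP => // jN Fj; exact: (Fdisj _ _ _ iN jN Fi Fj).
rewrite (eq_bigr (fun k : 'I_N => lebesgue_tuple R n (G k))); last first.
  by move=> k _; rewrite vol_coords// /G ltn_ord.
rewrite -measure_bigsetU// vol_coords//; apply: le_measure; rewrite ?inE//.
  by apply: bigsetU_measurable => k _.
by rewrite -bigcup_mkord => t [k /= kN]; rewrite /G kN; exact: FA.
Qed.

Lemma coords_homothet v (c : R) A : 0 < c ->
  coords A = tuple_affine c (tuple_of_row v) @^-1` coords (homothet v c A).
Proof.
move=> c0; have E (t : Rn n) : \row_i tnth (tuple_affine c (tuple_of_row v) t) i = v + c *: \row_i tnth t i.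
  by apply/rowP => i; rewrite !mxE !tnth_mktuple addrC.
apply/seteqP; split => t; rewrite /coords /= E.
  by move=> At; exists (\row_i tnth t i).
move=> [x Ax] /addrI /(scalerI (lt0r_neq0 c0)) <- //.
Qed.

Lemma measurable_coords_homothet v (c : R) A : 0 < c ->
  measurable (coords A) -> measurable (coords (homothet v c A)).
Proof.
move=> c0 mA; rewrite (_ : homothet v c A = [set x | A (- (c^-1 *: v) + c^-1 *: x)]).
  rewrite (_ : coords _ = tuple_affine c^-1 (tuple_of_row (- (c^-1 *: v))) @^-1` coords A).
    by rewrite -[X in measurable X]setTI; exact: measurable_tuple_affine.
  apply/seteqP; split => t; rewrite /coords /=;
    (rewrite (_ : \row_i tnth (tuple_affine _ _ _) i = - (c^-1 *: v) + c^-1 *: \row_i tnth t i)//;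
    by apply/rowP => i; rewrite !mxE !tnth_mktuple !mxE addrC).
have cn0 := lt0r_neq0 c0.
apply/seteqP; split => x /=.
  by move=> [y Ay <-]; rewrite scalerDr scalerA mulVf// scale1r addKr.
by move=> Ax; exists (- (c^-1 *: v) + c^-1 *: x) => //; rewrite scalerDr scalerN !scalerA mulfV// !scale1r addNKr.
Qed.

Lemma vol_homothet v (c : R) A : 0 < c -> measurable (coords A) ->
  vol (homothet v c A) = ((c ^+ n)%:E * vol A)%E.
Proof.
move=> c0 mA; have mcA := measurable_coords_homothet v c0 mA.
rewrite !vol_coords// (lebesgue_tuple_affine (tuple_of_row v) c0 mcA).
by rewrite -coords_homothet.
Qed.

Lemma vol_interior_gt0 A : A° !=set0 -> (0 < vol A)%E.
Proof.
move=> [x /nbhs_ballP[e /= e0 eA]].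
pose B i : set (measurableTypeR R) := ball (x ord0 i : R) e.
apply: (@lt_le_trans _ _ (vol [set y | forall i, B i (y ord0 i)])); last first.
  by apply: le_vol => y By; apply: eA; split => // i j; rewrite (ord1 i); exact: By.
rewrite vol_box; last by move=> i; exact: measurable_realfun.measurable_ball.
apply: (big_ind (fun z : \bar R => (0 < z)%E)) => // [a b|i _]; first exact: mule_gt0.
by rewrite lebesgue_measure_ball ?ltW// lte_fin pmulrn_lgt0.
Qed.

Lemma vol_compact_lty A : compact A -> (vol A < +oo)%E.
Proof.
move=> /compact_bounded[M [_ MA]].
(* [compact_bounded] gives bounds by the numbers strictly above [M], whence one unit; the second
   makes the inequality of the open ball strict. *)
pose B (i : 'I_n) : set (measurableTypeR R) := ball (0 : R) (`|M| + 2).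
apply: (@le_lt_trans _ _ (vol [set y | forall i, B i (y ord0 i)])).
  apply: le_vol => y Ay i; rewrite /B /ball /= sub0r normrN.
  have {}Ay : `|y| <= `|M| + 1.
    by apply: MA => //; rewrite (le_lt_trans (ler_norm M))// ltrDl.
  apply: (@le_lt_trans _ _ `|y|); last by lra.
  by rewrite [leRHS]/Num.Def.normr /= mx_normrE; apply/bigmax_geP; right => /=; exists (ord0, i).
rewrite vol_box; last by move=> i; exact: measurable_realfun.measurable_ball.
apply: (@proj2 (0 <= \big[*%E/1%E]_(i < n) @lebesgue_measure R (B i))%E).
apply: (big_ind (fun z : \bar R => (0 <= z)%E /\ (z < +oo)%E)) => //.
- by split => //; exact: ltry.
- by move=> a b [a0 a1] [b0 b1]; split; [exact: mule_ge0|rewrite lte_mul_pinfty// ge0_fin_numE].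
- by move=> i _; rewrite lebesgue_measure_ball ?addr_ge0// ltry lee_fin mulrn_wge0// addr_ge0.
Qed.

End volume.

(** * Unconditional bodies in product-maximal position *)

(** The product is 1 + e * sum + O(e^2), with a remainder bounded uniformly for e in [0, 1]; a
    positive sum would push it above 1 for small e. *)
Lemma prod_tangent (R : realFieldType) (n : nat) (a : 'I_n -> R) :
  (forall e, 0 <= e -> e <= 1 -> \prod_i (1 + e * a i) <= 1) ->
  \sum_i a i <= 0.
Proof.
have [M M0 HM] : exists2 M, 0 <= M & forall e, 0 <= e -> e <= 1 ->
    `|\prod_i (1 + e * a i) - 1 - e * \sum_i a i| <= e ^+ 2 * M.
  elim: n a => [|n IH] a.
    by exists 0 => // e _ _; rewrite !big_ord0 subrr mulr0 subr0 normr0 mulr0.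
  have [M M0 HM] := IH (fun i => a (lift ord0 i)).
  exists (M * (1 + `|a ord0|) + `|(\sum_(i < n) a (lift ord0 i)) * a ord0|).
    by rewrite addr_ge0// mulr_ge0// addr_ge0.
  move=> e e0 e1; rewrite !big_ord_recl; move: (HM e e0 e1).
  move: (\prod_(i < n) _) (\sum_(i < n) _) (a ord0) => P s x HP.
  rewrite (_ : _ - _ = (P - 1 - e * s) * (1 + e * x) + e ^+ 2 * (s * x)); last by ring.
  apply: le_trans (ler_normD _ _) _; rewrite [leRHS]mulrDr; apply: lerD; last first.
    by rewrite normrM ger0_norm// exprn_ge0.
  rewrite normrM mulrA; apply: ler_pM => //; apply: le_trans (ler_normD _ _) _; rewrite normr1 lerD2l normrM ger0_norm//.
  by rewrite ler_piMl.
move=> H; rewrite leNgt; apply/negP; set s := \sum_i _ => s0.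
have Ms : 0 < M + s by lra.
(* Small enough that [e * M < s], so that the linear term beats the remainder. *)
pose e := s / (M + s).
have e0 : 0 < e by rewrite divr_gt0.
have e1 : e <= 1 by rewrite ler_pdivrMr//; lra.
have := HM e (ltW e0) e1; have := H e (ltW e0) e1.
rewrite -/s ler_norml => P1 /andP[P2 _].
have : s <= e * M by rewrite -(ler_pM2l e0) mulrA -expr2; lra.
by rewrite /e mulrAC ler_pdivlMr//; nra.
Qed.

Section position.
Variables (R : realType) (n : nat) (Q : set 'rV[R]_n).
Hypotheses (bQ : convex_body Q) (uQ : unconditional Q).

Lemma convex_body_conv x y (l : R) :
  Q x -> Q y -> 0 <= l -> l <= 1 -> Q (l *: x + (1 - l) *: y).
Proof.
move=> Qx Qy l0 l1; case: bQ => _ cQ _.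
have := cQ x y (Itv01 l0 l1); rewrite !inE => /(_ Qx Qy).
by [].
Qed.

Lemma unconditional_flip e x : Q x -> Q (flip_signs e x).
Proof. by move=> Qx; rewrite -(uQ e); exists x. Qed.

Lemma unconditional_opp x : Q x -> Q (- x).
Proof.
move=> Qx; rewrite (_ : - x = flip_signs (fun=> true) x); first exact: unconditional_flip.
by apply/rowP => i; rewrite !mxE mulN1r.
Qed.

Lemma unconditional_abs x : Q x -> Q (\row_i `|x ord0 i|).
Proof.
move=> Qx; rewrite (_ : \row_i _ = flip_signs (fun i => x ord0 i < 0) x); first exact: unconditional_flip.
by apply/rowP => i; rewrite !mxE normrEsign.
Qed.

Lemma unconditional_0 : Q 0.
Proof.
case: bQ => _ _ [x /interior_subset Qx].
have h0 : 0 <= 1 / 2 :> R by lra.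
have h1 : 1 / 2 <= 1 :> R by lra.
have := convex_body_conv Qx (unconditional_opp Qx) h0 h1.
by rewrite scalerN (_ : 1 - 1 / 2 = 1 / 2) ?subrr//; lra.
Qed.

Lemma convex_body_scale x (l : R) : Q x -> 0 <= l -> l <= 1 -> Q (l *: x).
Proof.
move=> Qx l0 l1; have := convex_body_conv Qx unconditional_0 l0 l1.
by rewrite scaler0 addr0.
Qed.

(** This makes the maximum of the product of the absolute coordinates over [Q] positive, so that the
    maximizer has no zero coordinate. *)
Lemma interior_point_nonzero : exists2 x, Q x & forall i, x ord0 i != 0.
Proof.
case: bQ => _ _ [x /nbhs_ballP[e /= e0 eQ]].
exists (\row_i (if x ord0 i == 0 then e / 2 else x ord0 i)).
  apply: eQ; split => // i j; rewrite (ord1 i) mxE.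
  case: eqVneq => [->|_]; last exact: ballxx.
  by rewrite /ball /= sub0r normrN ger0_norm; lra.
move=> i; rewrite mxE; have [_|//] := eqVneq (x ord0 i) 0.
exact: lt0r_neq0 (divr_gt0 e0 (ltr0Sn R 1)).
Qed.

Lemma continuous_prod_abs : continuous (fun x : 'rV[R]_n => \prod_i `|x ord0 i|).
Proof.
move=> x; apply: cvg_big => [||i _]; [exact: mul_continuous|exact: nbhs_filter|].
apply: (@cvg_comp _ _ _ (fun y : 'rV[R]_n => y ord0 i) Num.norm); last exact: norm_continuous.
exact: coord_continuous.
Qed.

(* At a point [u] of maximal [prod |u i|] the tangent hyperplane of the level set of
   this product supports [Q]. *)
Lemma unconditional_position : exists u, [/\ Q u, forall i, 0 < u ord0 i &
  forall q, Q q -> \sum_i `|q ord0 i / u ord0 i| <= n%:R].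
Proof.
have [x Qx x0] := interior_point_nonzero.
have [u] : exists2 u, u \in Q & forall t, t \in Q -> \prod_i `|t ord0 i| <= \prod_i `|u ord0 i|.
  apply: EVT_max_rV; first by exists x.
    by case: bQ.
  exact/continuous_subspaceT/continuous_prod_abs.
rewrite inE => Qu umax.
have u0 i : u ord0 i != 0.
  have : 0 < \prod_i `|u ord0 i|.
    apply: (@lt_le_trans _ _ (\prod_i `|x ord0 i|)); last by apply: umax; rewrite inE.
    by apply: prodr_gt0 => j _; rewrite normr_gt0.
  by apply: contraTneq => ui; rewrite (bigD1 i)//= ui normr0 mul0r ltxx.
have v0 i : 0 < `|u ord0 i| by rewrite normr_gt0.
exists (\row_i `|u ord0 i|); split => [||q Qq]; first exact: unconditional_abs.
  by move=> i; rewrite mxE.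
rewrite (eq_bigr (fun i => (`|q ord0 i| / `|u ord0 i| - 1) + 1)); last first.
  by move=> i _; rewrite mxE normrM normfV normr_id subrK.
rewrite big_split /= sumr_const card_ord -[leRHS]add0r lerD2r.
(* The segment from [|u|] to [|q|] stays in [Q]; the product along it, divided by its maximal value,
   is the product in [prod_tangent]. *)
apply: prod_tangent => e e0 e1.
have Qc := convex_body_conv (unconditional_abs Qq) (unconditional_abs Qu) e0 e1.
have := umax _ (mem_set Qc).
rewrite (eq_bigr (fun i => `|u ord0 i| * (1 + e * (`|q ord0 i| / `|u ord0 i| - 1)))).
  by rewrite big_split /= ger_pMr// prodr_gt0.
move=> i _; rewrite !mxE ger0_norm; last first.
  by apply: addr_ge0; apply: mulr_ge0 => //; lra.
by field; rewrite ?normr_eq0 ?u0.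
Qed.

End position.

(** * The body *)

Lemma continuous_min (R : realType) (T : topologicalType) (f g : T -> R) :
  continuous f -> continuous g -> continuous (fun x => Num.min (f x) (g x)).
Proof.
move=> cf cg x; rewrite (_ : (fun x => _) = fun x => - ((fun x => - f x) \max (fun x => - g x)) x).
  apply: cvgN; apply: (@continuous_max R T (fun x => - f x) (fun x => - g x)).
    by apply: cvgN; exact: cf.
  by apply: cvgN; exact: cg.
by apply/funext => y /=; rewrite -oppr_min opprK.
Qed.

Lemma continuous_clip (R : realType) : continuous (@clip R).
Proof.
move=> x; apply: (@continuous_max R R (cst (-1)) (fun y => Num.min 1 y)).
  exact: cvg_cst.
by apply: (@continuous_min _ _ (cst 1) id) => y; [exact: cvg_cst|exact: cvg_id].
Qed.

Lemma continuous_scale_shift (R : realType) n (v : 'rV[R]_n) (c : R) :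
  continuous (fun y : 'rV[R]_n => c *: (y - v)).
Proof.
move=> y; have FF : Filter (nbhs y) by exact: nbhs_filter.
apply: (@cvgZ _ _ _ (nbhs y) FF (fun=> c) (fun y => y - v)); first exact: cvg_cst.
apply: (@cvgB _ _ _ (nbhs y) FF id (fun=> v)); first exact: cvg_id.
exact: (@cvg_cst _ _ _ (nbhs y) FF).
Qed.

Section body.
Variables (R : realType) (n : nat) (Q : set 'rV[R]_n).
Hypotheses (n5 : (5 <= n)%N) (bQ : convex_body Q) (uQ : unconditional Q).
Variable u : 'rV[R]_n.
Hypotheses (Qu : Q u) (u_gt0 : forall i, 0 < u ord0 i).
Hypothesis Q_sub : forall q, Q q -> \sum_i `|q ord0 i / u ord0 i| <= n%:R.
Variables (b dl : R).
Hypotheses (b_gt0 : 0 < b) (dl_gt0 : 0 < dl) (dl_small : dl <= 1 / 1000 / 100).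

Let n5R : 5 <= n%:R :> R. Proof. by rewrite ler_nat. Qed.

Lemma convex_body_comb x y (a c : R) :
  Q x -> Q y -> 0 <= a -> 0 <= c -> a + c <= 1 -> Q (a *: x + c *: y).
Proof.
move=> Qx Qy a0 c0 ac1.
have [ac|ac] := eqVneq (a + c) 0.
  have -> : a = 0 by lra.
  have -> : c = 0 by lra.
  by rewrite !scale0r addr0; exact: unconditional_0.
have ac0 : 0 < a + c by rewrite lt_neqAle eq_sym ac addr_ge0.
have a1 : 0 <= a / (a + c) by rewrite divr_ge0// ltW.
have a2 : a / (a + c) <= 1 by rewrite ler_pdivrMr//; lra.
have := convex_body_scale bQ uQ (convex_body_conv bQ Qx Qy a1 a2) (ltW ac0) ac1.
rewrite scalerDr !scalerA (_ : _ * (a / _) = a); last by field.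
by rewrite (_ : _ * (1 - _) = c)//; field.
Qed.

Definition point t w (q : 'rV[R]_n) : 'rV[R]_n := t *: u + w *: q.

Definition width t : R := dl * Num.min t b.

(* A cone with apex [0] and axis [u], continued by a cylinder. *)
Definition body : set 'rV[R]_n :=
  [set x | exists t q, [/\ 0 <= t, t <= 5 * b, Q q & x = point t (width t) q]].

Lemma width_ge0 t : 0 <= t -> 0 <= width t.
Proof. by move=> t0; rewrite mulr_ge0 ?le_min ?t0 ?ltW. Qed.

(** [Q] is star-shaped about 0, so thinner offsets stay in the cross-section. Zero width is treated
    apart because the proof divides by the width. *)
Lemma body_point t w q : 0 <= t -> t <= 5 * b -> 0 <= w -> w <= width t -> Q q ->
  body (point t w q).
Proof.
move=> t0 t5 w0 wt Qq; have [wE|wN] := eqVneq (width t) 0.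
  have -> : w = 0 by lra.
  exists t, 0; split => //; first exact: unconditional_0.
  by rewrite /point scale0r scaler0.
have wt0 : 0 < width t by rewrite lt_neqAle eq_sym wN width_ge0.
exists t, ((w / width t) *: q); split => //; last by rewrite /point scalerA mulrC divfK.
apply: convex_body_scale => //; first by rewrite divr_ge0// ltW.
by rewrite ler_pdivrMr// mul1r.
Qed.

Lemma width_concave t t' l : 0 <= l -> l <= 1 ->
  l * width t + (1 - l) * width t' <= width (l * t + (1 - l) * t').
Proof.
move=> l0 l1; rewrite /width !(mulrCA _ dl) -mulrDr ler_pM2l// le_min.
have l2 : 0 <= 1 - l by lra.
have h1 : Num.min t b <= t by rewrite ge_min lexx.
have h2 : Num.min t b <= b by rewrite ge_min lexx orbT.
have h3 : Num.min t' b <= t' by rewrite ge_min lexx.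
have h4 : Num.min t' b <= b by rewrite ge_min lexx orbT.
by apply/andP; split; nra.
Qed.

(** Convexity of [Q] merges the two offsets into a single one of size [w], the same convex
    combination of the widths; concavity of [width] bounds [w] by the width at the intermediate
    height. *)
Lemma body_conv x y (l : R) :
  body x -> body y -> 0 <= l -> l <= 1 -> body (l *: x + (1 - l) *: y).
Proof.
move=> [t [q [t0 t5 Qq ->]]] [t' [q' [t0' t5' Qq' ->]]] l0 l1.
have w0 := width_ge0 t0; have w0' := width_ge0 t0'.
have l2 : 0 <= 1 - l by lra.
set w := l * width t + (1 - l) * width t'.
have w1 : 0 <= w by rewrite addr_ge0// mulr_ge0.
have [z Qz zE] : exists2 z, Q z & (l * width t) *: q + ((1 - l) * width t') *: q' = w *: z.
  have [wE|wN] := eqVneq w 0.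
    have h1 : 0 <= l * width t by rewrite mulr_ge0.
    have h2 : 0 <= (1 - l) * width t' by rewrite mulr_ge0.
    exists 0; first exact: unconditional_0.
    have -> : l * width t = 0 by rewrite /w in wE; lra.
    have -> : (1 - l) * width t' = 0 by rewrite /w in wE; lra.
    by rewrite !scale0r addr0 scaler0.
  have wp : 0 < w by rewrite lt_neqAle eq_sym wN.
  exists ((l * width t / w) *: q + ((1 - l) * width t' / w) *: q').
    apply: convex_body_comb => //.
    - by rewrite divr_ge0// mulr_ge0.
    - by rewrite divr_ge0// mulr_ge0.
    - by rewrite -mulrDl divff.
  by rewrite scalerDr !scalerA !(mulrC w) !divfK.
rewrite (_ : _ + _ = point (l * t + (1 - l) * t') w z).
  apply: body_point => //; [by rewrite addr_ge0// mulr_ge0|by nra|exact: width_concave].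
by rewrite /point -zE !scalerDr !scalerA scalerDl addrACA.
Qed.

Lemma convex_set_body : convex_set body.
Proof.
move=> x y l; rewrite !inE => bx by_.
by apply: (body_conv bx by_); [exact: ge0|exact: le1].
Qed.

Lemma compact_body : compact body.
Proof.
pose f (p : R * 'rV[R]_n) : 'rV[R]_n := p.1 *: u + (dl * Num.min p.1 b) *: p.2.
rewrite (_ : body = f @` (`[0, 5 * b] `*` Q)).
  apply: continuous_compact; last first.
    by apply: compact_setX; [exact: segment_compact|case: bQ].
  apply: continuous_subspaceT => p; apply: cvgD.
    by apply: cvgZr_tmp; exact: cvg_fst.
  apply: cvgZ; last exact: cvg_snd.
  apply: cvgM; first exact: cvg_cst.
  by apply: (@continuous_min _ _ fst (cst b)) => y; [exact: cvg_fst|exact: cvg_cst].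
apply/seteqP; split => x /=.
  by move=> [t [q [t0 t5 Qq ->]]]; exists (t, q) => //; split => //=; rewrite in_itv /= t0.
by move=> [[t q] [/= + Qq] <-]; rewrite in_itv /= => /andP[t0 t5]; exists t, q.
Qed.

Lemma homothet_sub_body : homothet ((3 * b) *: u) (dl * b) Q `<=` body.
Proof.
move=> _ [q Qq <-]; have b0 := b_gt0; have d0 := dl_gt0.
apply: body_point => //; [by lra|by lra|by rewrite ltW// mulr_gt0|].
by rewrite /width (min_idPr _)//; lra.
Qed.

(** The centre is the midpoint of the axis. As [u] and [- u] lie in [Q], the axial displacement
    costs at most [5 / 2 * b] and the offset at most [dl * b]. *)
Lemma body_sub_homothet rho : 5 / 2 * b + dl * b <= rho ->
  body `<=` homothet ((5 / 2 * b) *: u) rho Q.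
Proof.
move=> hrho _ [t [q [t0 t5 Qq ->]]]; have b0 := b_gt0; have d0 := dl_gt0.
have db0 : 0 < dl * b by rewrite mulr_gt0.
have rho0 : 0 < rho by lra.
have w0 := width_ge0 t0.
have w1 : width t <= dl * b by rewrite ler_pM2l// ge_min lexx orbT.
have [e [Qe et]] : exists e, Q e /\ (t - 5 / 2 * b) *: u = `|t - 5 / 2 * b| *: e.
  have [h|h] := leP 0 (t - 5 / 2 * b); first by exists u; rewrite ger0_norm.
  exists (- u); split; first exact: unconditional_opp.
  by rewrite ltr0_norm// scalerN scaleNr opprK.
have ta : `|t - 5 / 2 * b| <= 5 / 2 * b by rewrite ler_norml; apply/andP; split; lra.
exists ((`|t - 5 / 2 * b| / rho) *: e + (width t / rho) *: q).
  apply: convex_body_comb => //; [by rewrite divr_ge0// ltW|by rewrite divr_ge0// ltW|].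
  by rewrite -mulrDl ler_pdivrMr//; lra.
rewrite scalerDr !scalerA !(mulrC rho) !divfK ?gt_eqF// -et addrA -scalerDl.
by rewrite (addrC (5 / 2 * b)) subrK.
Qed.

Lemma convex_body_body : convex_body body.
Proof.
split; [exact: compact_body|exact: convex_set_body|].
have [_ _ [x Qx]] := bQ.
have db0 : 0 < dl * b by rewrite mulr_gt0.
have dbn := lt0r_neq0 db0.
exists ((3 * b) *: u + (dl * b) *: x).
have cx : (dl * b)^-1 *: ((3 * b) *: u + (dl * b) *: x - (3 * b) *: u) = x.
  by rewrite addrAC subrr add0r scalerA mulVf// scale1r.
have : nbhs ((3 * b) *: u + (dl * b) *: x) [set y | Q ((dl * b)^-1 *: (y - (3 * b) *: u))].
  by apply: (@continuous_scale_shift R n _ _ _ Q); rewrite cx.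
apply: filterS => y /= Qy; apply: homothet_sub_body; exists ((dl * b)^-1 *: (y - (3 * b) *: u)) => //.
by rewrite scalerA mulfV// scale1r addrC subrK.
Qed.


(** * Truncated cuts *)

Definition level h d (x : 'rV[R]_n) : R := \sum_i clip ((x ord0 i / u ord0 i - h) / d).

Definition lower h d : set 'rV[R]_n := body `&` [set x | level h d x <= 0].

(** A measurable superset of the boundary of [lower]; the outer measure of the boundary is only
    estimated through it. *)
Definition layer h d : set 'rV[R]_n := body `&` [set x | 0 < level h d x /\ level h d x <= 2].

Lemma continuous_level h d : continuous (level h d).
Proof.
move=> x; apply: cvg_big => [||i _]; [exact: add_continuous|exact: nbhs_filter|].
apply: (@cvg_comp _ _ _ (fun y : 'rV[R]_n => y ord0 i) (fun z => clip ((z / u ord0 i - h) / d))).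
  exact: coord_continuous.
apply: (@cvg_comp _ _ _ (fun z : R => (z / u ord0 i - h) / d) (@clip R)); last exact: continuous_clip.
by apply: cvgMr_tmp; apply: cvgB; [apply: cvgMr_tmp; exact: cvg_id|exact: cvg_cst].
Qed.

Lemma closed_body : closed body.
Proof. by apply: compact_closed; [exact: norm_hausdorff|exact: compact_body]. Qed.

Lemma closed_level_le h d c : closed [set x | level h d x <= c].
Proof.
rewrite (_ : mkset _ = level h d @^-1` [set y | y <= c])//.
apply: preimage_closed; last exact: closed_le.
by move=> x _; exact: continuous_level.
Qed.

Lemma closed_lower h d : closed (lower h d).
Proof. by apply: closedI; [exact: closed_body|exact: closed_level_le]. Qed.

Lemma measurable_body : measurable (coords body).
Proof. by apply: measurable_coords_closed; exact: closed_body. Qed.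

Lemma measurable_lower h d : measurable (coords (lower h d)).
Proof. by apply: measurable_coords_closed; exact: closed_lower. Qed.

Lemma measurable_layer h d : measurable (coords (layer h d)).
Proof.
rewrite (_ : coords _ = coords (body `&` [set x | level h d x <= 2]) `\` coords [set x | level h d x <= 0]).
  apply: measurableD; apply: measurable_coords_closed; last exact: closed_level_le.
  by apply: closedI; [exact: closed_body|exact: closed_level_le].
apply/seteqP; split => t; rewrite /coords /layer /=.
  by move=> [? [/lt_geF -> ?]]; split.
by move=> [[? ?] /negP]; rewrite -ltNge.
Qed.

Lemma l0_boundary_lower h d : l0_boundary body (lower h d) `<=` layer h d.
Proof.
move=> y [[Ky Sy] [x [Kx Hx] xy]]; split => //; split.
  by rewrite ltNge; apply/negP => Hy; apply: Sy.
suff : level h d y - level h d x <= 2 by move: Hx => /=; lra.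
rewrite /level -sumrB.
apply: (@le_trans _ _ (\sum_(i | i \in [pred i | x ord0 i != y ord0 i]) (2 : R))); last first.
  by rewrite sumr_const; move: xy; case: #|_| => [|[|//]] _; rewrite ?mulr0n ?mulr1n.
rewrite [leRHS]big_mkcond /=; apply: ler_sum => i _; rewrite inE.
case: eqVneq => [->|_] /=; first by rewrite subrr.
by have := clip_le1 ((y ord0 i / u ord0 i - h) / d); have := clip_geN1 ((x ord0 i / u ord0 i - h) / d); lra.
Qed.

Lemma point_coord t w q i : point t w q ord0 i / u ord0 i = t + w * (q ord0 i / u ord0 i).
Proof. by rewrite !mxE; field; exact: lt0r_neq0. Qed.

Section level_point.
Variables (h d t w : R) (q : 'rV[R]_n).
Hypotheses (d0 : 0 < d) (w0 : 0 <= w) (wd : 1000 * w <= d) (Qq : Q q).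

Let p i := w * (q ord0 i / u ord0 i) / d.

(** By [Q_sub] the [|q i / u i|] have average at most 1, and [w / d] is at most 1/1000. *)
Let p_small : \sum_i `|p i| <= n%:R / 1000.
Proof.
rewrite (eq_bigr (fun i => w / d * `|q ord0 i / u ord0 i|)); last first.
  by move=> i _; rewrite /p mulrAC normrM ger0_norm// divr_ge0// ltW.
rewrite -mulr_sumr; have := Q_sub Qq; have n5' := n5R; have wd1 := wd.
move: (\sum_i _) => s sn.
have wd' : w / d <= 1 / 1000 by rewrite ler_pdivrMr//; lra.
have wd0 : 0 <= w / d by rewrite divr_ge0// ltW.
move: n5' sn; move: (n%:R : R) => N N5 sN; nra.
Qed.

Let pE i : (point t w q ord0 i / u ord0 i - h) / d = (t - h) / d + p i.
Proof. by rewrite point_coord -mulrDl addrAC. Qed.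

Lemma level_point_le2 : level h d (point t w q) <= 2 -> t - h <= 401 / 1000 * d.
Proof.
by move=> H; have := clip_sum_le2 n5 p_small pE H; rewrite ler_pdivrMr.
Qed.

Lemma level_point_gt0 : 0 < level h d (point t w q) -> - (1 / 1000) * d < t - h.
Proof.
by move=> H; have := clip_sum_gt0 n5 p_small pE H; rewrite ltr_pdivlMr.
Qed.

(** This is [clip_sum_drop] in unscaled coordinates. A definite drop is asked only of coordinates
    that deviate from the height by at most [d / 10]: a contraction lowers a coordinate in
    proportion to its size, hence hardly at all when it is near 0. *)
Lemma level_point_drop (x : 'rV[R]_n) :
  0 < level h d (point t w q) -> level h d (point t w q) <= 2 ->
  (forall i, clip ((x ord0 i / u ord0 i - h) / d) <=
             clip ((point t w q ord0 i / u ord0 i - h) / d)) ->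
  (forall i, `|w * (q ord0 i / u ord0 i)| <= 1 / 10 * d ->
     x ord0 i / u ord0 i <= point t w q ord0 i / u ord0 i - 21 / 10 / n%:R * d) ->
  level h d x <= 0.
Proof.
move=> h0 h2 hle hd; apply: (clip_sum_drop n5 p_small pE h0 h2 hle) => i.
rewrite /p normrM normfV (gtr0_norm d0) ler_pdivrMr// => /hd hi.
by rewrite ler_pdivrMr// mulrBl divfK ?gt_eqF//; lra.
Qed.

End level_point.


Lemma width_le t : width t <= dl * b.
Proof. by rewrite ler_pM2l// ge_min lexx orbT. Qed.

Lemma width_mono t t' : t <= t' -> width t <= width t'.
Proof. by move=> tt; rewrite ler_pM2l// le_min !ge_min tt lexx orbT. Qed.

Lemma point_shift t w q s : s *: u + point t w q = point (s + t) w q.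
Proof. by rewrite /point addrA -scalerDl. Qed.

Lemma body_shift t q s : 0 <= t -> Q q -> 0 <= s + t -> s + t <= 5 * b ->
  width t <= width (s + t) -> body (s *: u + point t (width t) q).
Proof.
move=> t0 Qq st0 st5 ww; rewrite point_shift.
by apply: body_point => //; exact: width_ge0.
Qed.

(** * A cut of the cylinder *)

Section half.
(** Midway between [2 * b] and [5 / 2 * b]: the slab is thin enough to confine the layer between
    these two heights, inside the cylinder. *)
Let h : R := 9 / 4 * b.
Let d : R := 1000 * (dl * b).

Let d0 : 0 < d. Proof. by have := mulr_gt0 dl_gt0 b_gt0; rewrite /d; lra. Qed.

Let d_small : d <= b / 100.
Proof.
have b0 := b_gt0; have ds := dl_small; rewrite /d.
have : dl * b <= 1 / 1000 / 100 * b by rewrite ler_pM2r.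
by lra.
Qed.

Let wd t : 1000 * width t <= d.
Proof. by have := width_le t; rewrite /d; lra. Qed.

Let hE : h = 9 / 4 * b. Proof. by []. Qed.

(** The offset [w] is independent of the height because a cone point translated upwards is closer to
    the axis than the width at its new height permits. *)
Lemma half_lt t w q : 0 <= w -> w <= dl * b -> Q q ->
  level h d (point t w q) <= 2 -> t < 5 / 2 * b.
Proof.
move=> w0 w1 Qq H; have b0 := b_gt0; have ds := d_small; have h1 := hE.
have wd1 : 1000 * w <= d by rewrite /d; lra.
have := @level_point_le2 h d t w q d0 w0 wd1 Qq; have l2 : level h d (point t w q) <= 2 by lra.
by move/(_ l2); lra.
Qed.

Lemma half_gt t q : 0 <= t -> Q q -> 0 < level h d (point t (width t) q) -> 2 * b < t.
Proof.
move=> t0 Qq H; have b0 := b_gt0; have ds := d_small; have h1 := hE.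
by have := @level_point_gt0 h d t (width t) q d0 (width_ge0 t0) (wd t) Qq H; lra.
Qed.

Lemma half_lower t q : 0 <= t -> t <= 2 * b -> Q q -> lower h d (point t (width t) q).
Proof.
move=> t0 t2 Qq; have b0 := b_gt0; split.
  by apply: body_point => //; [lra|exact: width_ge0].
by rewrite /= leNgt; apply/negP => /(half_gt t0 Qq); lra.
Qed.

(** The cut and its translate by [5 / 2 * b] along [u] are disjoint and both lie in the body: the
    cut ends below height [5 / 2 * b], where the translate begins. *)
Lemma half_le_half : (vol (lower h d) + vol (lower h d) <= vol body)%E.
Proof.
have b0 := b_gt0.
pose F k := homothet ((k%:R * (5 / 2 * b)) *: u) 1 (lower h d).
have -> : (vol (lower h d) + vol (lower h d) = \sum_(k < 2) vol (F k))%E.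
  rewrite big_ord_recr big_ord1 /= !vol_homothet//; try exact: measurable_lower.
  by rewrite expr1n mul1e.
have key x : lower h d x -> lower h d ((5 / 2 * b) *: u + x) -> False.
  move=> [[t [q [t0 t5 Qq ->]]] _] [_ /=]; rewrite point_shift => H.
  have : (5 / 2 * b + t) < 5 / 2 * b.
    by apply: (half_lt (width_ge0 t0) (width_le t) Qq); lra.
  by lra.
apply: sum_vol_disjoint_le.
- by move=> k; apply: measurable_coords_homothet => //; exact: measurable_lower.
- exact: measurable_body.
- move=> k _ k2 [x [[t [q [t0 t5 Qq ->]]] H] <-]; rewrite scale1r.
  have t2 : t < 5 / 2 * b.
    by apply: (half_lt (width_ge0 t0) (width_le t) Qq); move: H => /=; lra.
  case: k k2 => [|[|//]] _; apply: body_shift => //; try lra; apply: width_mono; lra.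
- move=> i j _ i2 j2 [x Sx <-] [y Sy]; rewrite !scale1r.
  case: i i2 => [|[|//]] _; case: j j2 => [|[|//]] _ //; rewrite !mul0r !scale0r !add0r !mul1r => E.
    by case: (key y Sy); rewrite E.
  by case: (key x Sx); rewrite -E.
Qed.

(** Translates by 0, b, 2b and 3b along [u] cover the body: a point above height [2 * b] moves down
    into heights from b to 2b, where the cross-section is the same and everything belongs to the
    cut. *)
Lemma body_le_4half : (vol body <= \sum_(k < 4) vol (lower h d))%E.
Proof.
have b0 := b_gt0.
pose F k := homothet ((k%:R * b) *: u) 1 (lower h d).
have FE k : vol (lower h d) = vol (F k).
  rewrite vol_homothet//; last exact: measurable_lower.
  by rewrite expr1n mul1e.
rewrite (eq_bigr (fun k : 'I_4 => vol (F k))); last by move=> k _; exact: FE.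
apply: vol_bigcup_le => x [t [q [t0 t5 Qq ->]]].
have shift k : b <= t - k%:R * b -> t - k%:R * b <= 2 * b -> F k (point t (width t) q).
  move=> h1 h2; exists (point (t - k%:R * b) (width (t - k%:R * b)) q).
    by apply: half_lower => //; lra.
  have kb : 0 <= k%:R * b by rewrite mulr_ge0// ltW.
  rewrite scale1r point_shift addrC subrK /width !(min_idPr _)//.
  by lra.
have [t2|t2] := leP t (2 * b).
  exists 0%N => //; exists (point t (width t) q); first exact: half_lower.
  by rewrite mul0r scale0r add0r scale1r.
have [t3|t3] := leP t (3 * b); first by exists 1%N => //; apply: shift; lra.
have [t4|t4] := leP t (4 * b); first by exists 2%N => //; apply: shift; lra.
by exists 3%N => //; apply: shift; lra.
Qed.

(** Lowering the layer by any amount between [eta] and b puts it into [lower]. Hence its translates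
    by multiples of [eta] are pairwise disjoint: an overlap would put a point of the layer into
    [lower]. *)
Lemma layer_packing N : N%:R * (21 / 10 / n%:R * d) <= b ->
  (\sum_(k < N) vol (layer h d) <= vol (lower h d))%E.
Proof.
set eta := 21 / 10 / n%:R * d => Nb; have b0 := b_gt0.
have n0 : 0 < n%:R :> R by have := n5R; lra.
have eta0 : 0 < eta by rewrite mulr_gt0// divr_gt0.
have drop s x : eta <= s -> s <= b -> layer h d x -> lower h d (- s *: u + x).
  move=> s1 s2 [[t [q [t0 t5 Qq ->]]] [H0 H2]].
  have t2 := half_gt t0 Qq H0.
  split.
    apply: body_shift => //; [lra|lra|].
    by rewrite /width !(min_idPr _)//; lra.
  have cE i : (- s *: u + point t (width t) q) ord0 i / u ord0 i = point t (width t) q ord0 i / u ord0 i - s.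
    by rewrite point_shift !point_coord; ring.
  apply: (level_point_drop d0 (width_ge0 t0) (wd t) Qq H0 H2) => i.
    rewrite cE; apply: clip_mono; rewrite ler_pM2r ?invr_gt0//; lra.
  by move=> _; rewrite cE -/eta; lra.
(* The shifts start at [eta], since the unshifted layer is outside [lower]. *)
pose F k := homothet (- (k.+1%:R * eta) *: u) 1 (layer h d).
have FE k : vol (layer h d) = vol (F k).
  rewrite vol_homothet//; last exact: measurable_layer.
  by rewrite expr1n mul1e.
rewrite (eq_bigr (fun k : 'I_N => vol (F k))); last by move=> k _; exact: FE.
have kN k : (k < N)%N -> k.+1%:R * eta <= b.
  by move=> kN; apply: le_trans Nb; rewrite ler_pM2r// ler_nat.
have disj i j x : (i < j)%N -> (j < N)%N -> F i x -> F j x -> False.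
  move=> ij jN [y Ey <-] [z Ez]; rewrite !scale1r => E.
  have ij1 : eta <= (j - i)%:R * eta by rewrite ler_peMl ?(ltW eta0)// ler1n subn_gt0.
  have ij2 : (j - i)%:R * eta <= b.
    by apply: le_trans (kN _ jN); rewrite ler_pM2r// ler_nat ltnW// ltnS leq_subr.
  have [_ /=] := drop _ _ ij1 ij2 Ez.
  have -> : - ((j - i)%:R * eta) *: u + z = y.
    rewrite natrB ?(ltnW ij)//.
    have -> : y = (i.+1%:R * eta) *: u + (- (j.+1%:R * eta) *: u + z).
      by rewrite E scaleNr addrA subrr add0r.
    rewrite addrA -scalerDl; congr (_ *: _ + _); rewrite -!natr1; ring.
  by case: Ey => _ [/lt_geF ->].
apply: sum_vol_disjoint_le.
- by move=> k; apply: measurable_coords_homothet => //; exact: measurable_layer.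
- exact: measurable_lower.
- move=> k _ kN' [x Ex <-]; rewrite scale1r; apply: drop => //; last exact: kN.
  by rewrite ler_peMl ?(ltW eta0)// ler1n.
- move=> i j x iN jN Fi Fj; have [ij|ji|//] := ltngtP i j.
    by case: (disj i j x ij jN Fi Fj).
  by case: (disj j i x ji iN Fj Fi).
Qed.

End half.


(** * Cuts of the cone *)

(** 1000 times the width of the cone at height [2 * h]. Being linear in [h], it makes the cuts at
    different heights homothetic. *)
Definition cone_slab h : R := 2 * (1000 * (dl * h)).

Lemma width_le_cone t : width t <= dl * t.
Proof. by rewrite ler_pM2l// ge_min lexx. Qed.

Lemma width_cone t : t <= b -> width t = dl * t.
Proof. by move=> tb; rewrite /width (min_idPl tb). Qed.

Lemma point_scale l t w q : l *: point t w q = point (l * t) (l * w) q.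
Proof. by rewrite /point scalerDr !scalerA. Qed.

Section cone.
Variable h : R.
Hypotheses (h_gt0 : 0 < h) (hb : h <= b / 2).
Let d : R := cone_slab h.

Let d0 : 0 < d.
Proof. by have := mulr_gt0 dl_gt0 h_gt0; rewrite /d /cone_slab; lra. Qed.

Let d_small : d <= h / 50.
Proof.
have h0 := h_gt0; have ds := dl_small; rewrite /d /cone_slab.
have : dl * h <= 1 / 1000 / 100 * h by rewrite ler_pM2r.
by lra.
Qed.

(* Far above [h] the perturbation is not small compared with the slab, but it is small
   compared with the height. *)
Lemma cone_lt t q : 0 <= t -> Q q -> level h d (point t (width t) q) <= 2 -> t < 2 * h.
Proof.
move=> t0 Qq H; rewrite ltNge; apply/negP => ht.
have h0 := h_gt0; have ds := d_small; have dp := d0; have dlp := dl_gt0; have dls := dl_small.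
(* If [dl * |z| <= 1/4], the coordinate is at least [3/4 * t], hence above [h + d], and its [clip]
   is 1; otherwise the left term is below -1. The sum is at least [n * (1 - 8 * dl)] > 2. *)
have : \sum_i (1 - 8 * dl * `|q ord0 i / u ord0 i|) <= level h d (point t (width t) q).
  apply: ler_sum => i _; rewrite point_coord; set z := q ord0 i / u ord0 i.
  have [zs|zb] := leP (dl * `|z|) (1 / 4); last first.
    by have := clip_geN1 ((t + width t * z - h) / d); lra.
  rewrite clip_1.
    have : 0 <= dl * `|z| by rewrite mulr_ge0// ltW.
    by lra.
  have w0 := width_ge0 t0; have w1 := width_le_cone t.
  have : `|width t * z| <= t * (1 / 4).
    rewrite normrM (ger0_norm w0).
    apply: (@le_trans _ _ (dl * t * `|z|)); first by rewrite ler_wpM2r.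
    by rewrite mulrAC mulrC ler_wpM2l.
  rewrite ler_norml => /andP[z1 _].
  by rewrite ler_pdivlMr//; lra.
rewrite sumrB -mulr_sumr sumr_const card_ord => H'.
have N5 := n5R; have sN := Q_sub Qq.
have : dl * \sum_i `|q ord0 i / u ord0 i| <= dl * n%:R by rewrite ler_pM2l.
have : dl * n%:R <= 1 / 1000 / 100 * n%:R by rewrite ler_pM2r//; lra.
by lra.
Qed.

Let wd t : t <= 2 * h -> 1000 * width t <= d.
Proof.
move=> th; have w1 := width_le_cone t; rewrite /d /cone_slab.
have : dl * t <= dl * (2 * h) by rewrite ler_pM2l.
by lra.
Qed.

Lemma cone_gt t q : 0 <= t -> t <= 2 * h -> Q q -> 0 < level h d (point t (width t) q) ->
  h - h / 1000 < t.
Proof.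
move=> t0 th Qq H; have h0 := h_gt0; have ds := d_small.
by have := @level_point_gt0 h d t (width t) q d0 (width_ge0 t0) (wd th) Qq H; lra.
Qed.

(** Heights up to [2 * h <= b] belong to the cone, which scaling about the apex preserves up to
    height b. *)
Lemma cone_scale t l q : 0 <= t -> t <= 2 * h -> Q q -> 0 <= l -> l * t <= b ->
  body (l *: point t (width t) q).
Proof.
move=> t0 th Qq l0 lt1; have h0 := h_gt0; have hb' := hb; have b0 := b_gt0.
rewrite width_cone ?point_scale; last by lra.
have lt0 : 0 <= l * t by rewrite mulr_ge0.
apply: body_point => //; first by lra.
  by rewrite mulr_ge0// mulr_ge0// ltW.
by rewrite width_cone// mulrCA.
Qed.

(** Equal to [3 * d / (n * h)]: contracting by [1 + eta] lowers a coordinate close to [h] by nearly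
    [3 * d / n], more than the required [21/10 * d / n]. *)
Let eta : R := 6 * (1000 * dl) / n%:R.

Let n0 : 0 < n%:R :> R. Proof. by have := n5R; lra. Qed.

Let eta0 : 0 < eta.
Proof. by have dlp := dl_gt0; apply: (divr_gt0 _ n0); lra. Qed.

Let eta_n : eta * n%:R = 6 * (1000 * dl).
Proof. by apply: divfK; rewrite gt_eqF. Qed.

Let eta_small : eta <= 1 / 50.
Proof.
have := n5R; have := eta_n; have := dl_small; have := eta0; move: (n%:R : R) => N e0 ds eN N5.
have : eta * 5 <= eta * N by rewrite ler_pM2l.
by lra.
Qed.

Let e : R := (1 + eta)^-1.

Let e0 : 0 < e. Proof. by have := eta0; rewrite /e invr_gt0; lra. Qed.

Let eE : e * (1 + eta) = 1.
Proof. by rewrite /e mulVf// gt_eqF//; have := eta0; lra. Qed.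

Let e1 : e <= 1. Proof. by have := eE; have := e0; have := eta0; nra. Qed.

(** Contraction raises a negative [z], but then both arguments are at most [- h / d <= -1] and both
    values are -1. *)
Let clip_shrink z : clip ((e * z - h) / d) <= clip ((z - h) / d).
Proof.
have [z0|z0] := leP 0 z.
  apply: clip_mono; rewrite ler_pM2r ?invr_gt0// lerD2r.
  by have := e1; nra.
have ds := d_small; have h0 := h_gt0; have dp := d0.
have ez : e * z <= 0 by have := e0; nra.
by rewrite !clip_N1// ler_pdivrMr//; lra.
Qed.

Let scaleE (x : 'rV[R]_n) i : (e *: x) ord0 i / u ord0 i = e * (x ord0 i / u ord0 i).
Proof. by rewrite mxE mulrA. Qed.

Let body_shrink x : body x -> level h d x <= 2 -> body (e *: x).
Proof.
move=> [t [q [t0 t5 Qq ->]]] H; have th := ltW (cone_lt t0 Qq H).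
apply: cone_scale => //; first exact: ltW e0.
have hb' := hb; have e1' := e1; have := ltW e0; nra.
Qed.

Lemma cone_lower_shrink x : lower h d x -> lower h d (e *: x).
Proof.
move=> [Kx Hx]; split; first by apply: body_shrink => //; move: Hx => /=; lra.
apply: le_trans Hx; apply: ler_sum => i _; rewrite scaleE; exact: clip_shrink.
Qed.

Lemma cone_layer_shrink x : layer h d x -> lower h d (e *: x).
Proof.
move=> [Kx [H0 H2]]; split; first exact: body_shrink.
move: Kx H0 H2 => [t [q [t0 t5 Qq ->]]] H0 H2.
have th := ltW (cone_lt t0 Qq H2); have tg := cone_gt t0 th Qq H0.
apply: (level_point_drop d0 (width_ge0 t0) (wd th) Qq H0 H2) => i; rewrite scaleE.
  exact: clip_shrink.
rewrite point_coord; set z := t + _ => pz.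
(* The deviation is at most [d / 10], and [d] is at most [h / 50]. The drop is then at least
   [81/100 * eta * h], while [21/30 * eta * h] is needed. *)
have zh : 9 / 10 * h <= z.
  move: pz; rewrite ler_norml => /andP[p1 _]; have ds := d_small; have h0 := h_gt0; rewrite /z; lra.
have -> : 21 / 10 / n%:R * d = 21 / 30 * eta * h by rewrite /d /cone_slab /eta; field; exact: lt0r_neq0.
have e2 : 9 / 10 <= e by have := eE; have := eta_small; have := e0; nra.
have ee := eE; have ehp : 0 < eta * h by rewrite mulr_gt0.
have : 9 / 10 * (eta * h) <= e * (eta * h) by rewrite ler_pM2r.
have : e * eta * (9 / 10 * h) <= e * eta * z by rewrite ler_pM2l// mulr_gt0.
have : e * (1 + eta) * z = z by rewrite ee mul1r.
by lra.
Qed.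

(** The cut and the layer are disjoint, and contraction by [1 + eta] maps both into the cut, so both
    fit into its dilate. *)
Lemma cone_layer_vol :
  (vol (lower h d) + vol (layer h d) <= ((1 + eta) ^+ n)%:E * vol (lower h d))%E.
Proof.
have et := eta0; have et1 : 0 < 1 + eta by lra.
have eN : 1 + eta != 0 by exact: lt0r_neq0.
rewrite -(vol_homothet 0 et1 (measurable_lower h d)).
pose F k := if k == 0%N then lower h d else layer h d.
have -> : (vol (lower h d) + vol (layer h d) = \sum_(k < 2) vol (F k))%E.
  by rewrite big_ord_recr big_ord1.
have up x : lower h d (e *: x) -> homothet 0 (1 + eta) (lower h d) x.
  by move=> Hx; exists (e *: x) => //; rewrite add0r scalerA mulfV// scale1r.
apply: sum_vol_disjoint_le.
- by move=> k; rewrite /F; case: ifP => _; [exact: measurable_lower|exact: measurable_layer].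
- by apply: measurable_coords_homothet => //; exact: measurable_lower.
- move=> k x _; rewrite /F; case: ifP => _ Hx; apply: up.
    exact: cone_lower_shrink.
  exact: cone_layer_shrink.
- move=> i j x; case: i => [|[|//]] _; case: j => [|[|//]] _ //.
    by move=> [_ /= L] [_ [/lt_geF]]; rewrite L.
  by move=> [_ [/lt_geF L _]] [_ /=]; rewrite L.
Qed.

Lemma cone_rescale k x : 0 < k -> k <= b / 2 -> lower h d x ->
  lower k (cone_slab k) ((k / h) *: x).
Proof.
move=> k0 kb [[t [q [t0 t5 Qq ->]]] H]; have h0 := h_gt0.
have th : t < 2 * h by apply: (cone_lt t0 Qq); move: H => /=; lra.
split.
  apply: cone_scale => //; [exact: ltW|by rewrite divr_ge0// ltW|].
  by rewrite mulrAC ler_pdivrMr//; nra.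
(* Coordinates, height and slab all scale by [k / h], so each argument of [clip] is unchanged. *)
rewrite /= (_ : level _ _ _ = level h d (point t (width t) q))//.
apply: eq_bigr => i _; congr clip; rewrite /d /cone_slab mxE; field.
by rewrite !lt0r_neq0.
Qed.

End cone.

Lemma cone_lower_homothet h : 0 < h -> h <= b / 2 ->
  lower h (cone_slab h) = homothet 0 (h / (b / 2)) (lower (b / 2) (cone_slab (b / 2))).
Proof.
move=> h0 hb; have b0 := b_gt0; have b20 : 0 < b / 2 by lra.
apply/seteqP; split => x.
  move=> Hx; exists ((b / 2 / h) *: x); first exact: cone_rescale.
  by rewrite add0r scalerA [X in X *: _](_ : _ = 1) ?scale1r//; field; rewrite !lt0r_neq0.
by move=> [y Hy <-]; rewrite add0r; apply: cone_rescale.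
Qed.

(** Shrunk by 20, the body has height at most [b / 4] and fits in the cone, well below the cut at
    [b / 2]. *)
Lemma body_le_cone :
  (vol body <= ((20 ^+ n)%:E * vol (lower (b / 2) (cone_slab (b / 2)))))%E.
Proof.
have b0 := b_gt0; have b20 : 0 < b / 2 by lra.
have h20 : (0 : R) < 20 by [].
rewrite -(vol_homothet 0 h20); last exact: measurable_lower.
apply: le_vol => x [t [q [t0 t5 Qq ->]]].
exists (20^-1 *: point t (width t) q); last by rewrite add0r scalerA mulfV// scale1r.
have w1 := width_le_cone t; have w0 := width_ge0 t0.
have dls := dl_small; have dlp := dl_gt0.
have dt : dl * t <= dl * (5 * b) by rewrite ler_pM2l.
have db : dl * b <= 1 / 1000 / 100 * b by rewrite ler_pM2r.
rewrite point_scale; split.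
  apply: body_point => //; [lra|lra|lra|].
  by rewrite (@width_cone (20^-1 * t)); lra.
rewrite /= leNgt; apply/negP => H.
have c0 : 0 < cone_slab (b / 2) by have := mulr_gt0 dlp b0; rewrite /cone_slab; lra.
have w2 : 0 <= 20^-1 * width t by lra.
have w3 : 1000 * (20^-1 * width t) <= cone_slab (b / 2) by rewrite /cone_slab; lra.
have := level_point_gt0 c0 w2 w3 Qq H; rewrite /cone_slab; lra.
Qed.


(** * Volume ratios of the cuts *)

Lemma vol_real A : A `<=` body -> exists2 a, 0 <= a & vol A = a%:E.
Proof.
move=> AK; have Aoo : vol A \is a fin_num.
  by rewrite ge0_fin_numE ?vol_ge0// (le_lt_trans (le_vol AK))// vol_compact_lty//; exact: compact_body.
by exists (fine (vol A)); [rewrite fine_ge0 ?vol_ge0|rewrite fineK].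
Qed.

Lemma vol_body_real : exists2 k, 0 < k & vol body = k%:E.
Proof.
have [k _ kE] := vol_real (@subset_refl _ body); exists k => //.
rewrite -lte_fin -kE; apply: vol_interior_gt0.
by case: (convex_body_body).
Qed.

Lemma lower_sub h d : lower h d `<=` body. Proof. by move=> x []. Qed.

Lemma layer_sub h d : layer h d `<=` body. Proof. by move=> x []. Qed.

Lemma vol_boundary_real h d : exists2 p, vol (l0_boundary body (lower h d)) = p%:E &
  (p%:E <= vol (layer h d))%E.
Proof.
have Bl := @l0_boundary_lower h d.
have [p _ pE] := vol_real (subset_trans Bl (@layer_sub h d)).
by exists p => //; rewrite -pE; exact: le_vol.
Qed.

Let EFin_div (x y : R) : 0 < y -> (x%:E / y%:E)%E = (x / y)%:E.
Proof. by move=> y0; rewrite inver gt_eqF. Qed.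

Lemma exists_half : exists S, [/\ borel S, S `<=` body,
  ((1 / 4)%:E <= vol S / vol body <= (1 / 2)%:E)%E &
  (vol (l0_boundary body S) / vol S <= (5 * (1000 * dl) / n%:R)%:E)%E].
Proof.
have b0 := b_gt0; have n5' := n5R; have dlp := dl_gt0; have dls := dl_small.
have db : 0 < dl * b by rewrite mulr_gt0.
set h := 9 / 4 * b; set d := 1000 * (dl * b).
exists (lower h d).
have [k k0 kE] := vol_body_real; have [s s0 sE] := vol_real (@lower_sub h d).
have [e e0 eE] := vol_real (@layer_sub h d); have [p pE pe] := vol_boundary_real h d.
have := half_le_half; have := body_le_4half; rewrite -/h -/d sE kE => k4 k2.
have {}k2 : s + s <= k by rewrite -lee_fin.
have {}k4 : k <= 4 * s.
  by move: k4; rewrite !big_ord_recr big_ord0 /= add0e -!EFinD lee_fin; lra.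
have sp : 0 < s by lra.
have {}pe : p <= e by rewrite -lee_fin -eE.
split.
- by apply: borel_closed; exact: closed_lower.
- exact: lower_sub.
- by rewrite EFin_div// !lee_fin ler_pdivlMr// ler_pdivrMr//; apply/andP; split; lra.
rewrite pE EFin_div// lee_fin ler_pdivrMr//.
have n0 : 0 < n%:R :> R by lra.
set eta := 21 / 10 / n%:R * d.
have etaE : eta * n%:R = 21 / 10 * d by rewrite /eta mulrAC divfK// gt_eqF.
have eta0 : 0 < eta by rewrite -(pmulr_lgt0 _ n0) etaE /d; lra.
have dsmall : d <= b / 100.
  have : dl * b <= 1 / 1000 / 100 * b by rewrite ler_pM2r.
  by rewrite /d; lra.
(* Thus [b / eta] is at least 2, and its integer part [N] is at least half of it. Packing bounds the
   ratio by [1 / N <= 2 * eta / b], which is [4.2 * 1000 * dl / n]. *)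
have eta_small : 2 * eta <= b.
  have : eta * 5 <= eta * n%:R by rewrite ler_pM2l.
  by lra.
pose N := Num.truncn (b / eta).
have /andP[N1 N2] : N%:R <= b / eta < N.+1%:R by apply: truncn_itv; rewrite divr_ge0// ltW.
have {}N1 : N%:R * eta <= b by rewrite -ler_pdivlMr.
have {}N2 : b < (N%:R + 1) * eta by rewrite -ltr_pdivrMr// natr1.
have := layer_packing N1; rewrite -/h -/d sE eE sumEFin sumr_const card_ord lee_fin -mulr_natl => Ne.
have Nb : b <= 2 * eta * N%:R by lra.
have : b * e <= 2 * eta * s.
  apply: (@le_trans _ _ (2 * eta * N%:R * e)); first by rewrite ler_wpM2r.
  by rewrite -mulrA ler_pM2l//; lra.
move=> H; apply: (le_trans pe); rewrite -(ler_pM2l b0) (le_trans H)//.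
rewrite -(ler_pM2r n0).
have -> : 2 * eta * s * n%:R = 2 * (eta * n%:R) * s by ring.
rewrite (_ : b * _ * n%:R = 5 * (1000 * (dl * b)) * s); last first.
  by rewrite ?mulr1; field; exact: lt0r_neq0.
by rewrite etaE -/d ler_pM2r//; rewrite /d; lra.
Qed.

Lemma exists_small s : 0 < s -> s < expR (- (19 * n%:R)) ->
  exists S, [/\ borel S, S `<=` body, (vol S / vol body = s%:E)%E &
  (vol (l0_boundary body S) / vol S <= (12 * (1000 * dl))%:E)%E].
Proof.
move=> s0 sn; have b0 := b_gt0; have n5' := n5R; have dlp := dl_gt0; have dls := dl_small.
have n0 : 0 < n%:R :> R by lra.
have b20 : 0 < b / 2 by lra.
have [k k0 kE] := vol_body_real.
have [m m0 mE] := vol_real (@lower_sub (b / 2) (cone_slab (b / 2))).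
have := body_le_cone; rewrite kE mE -EFinM lee_fin => km.
have e20 : 0 < 20 ^+ n :> R by rewrite exprn_gt0.
have mp : 0 < m by rewrite -(pmulr_rgt0 _ e20); lra.
(* The exponent 19 comes from [exp 19 >= 1 + 19 = 20], where 20 is the factor of [body_le_cone]. *)
have s20 : s * 20 ^+ n <= 1.
  have : expR (- (19 * n%:R)) * 20 ^+ n <= 1 :> R.
    rewrite -mulNr expRM_natr -exprMn exprn_ile1//.
    by rewrite expRN mulrC ler_pdivrMr ?expR_gt0// mul1r; have := expR_ge1Dx (19 : R); lra.
  by apply: le_trans; rewrite ler_pM2r// ltW.
(* Volume scales with the n-th power of the height, so this root gives a cut of volume exactly
   [s * k]; [s20] yields [l <= 1], which keeps its height within [b / 2]. *)
pose l : R := (s * k / m) `^ (n%:R^-1).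
have skm : 0 < s * k / m by rewrite divr_gt0// mulr_gt0.
have ln : l ^+ n = s * k / m.
  by rewrite -powR_mulrn ?powR_ge0// /l -powRrM mulVf ?gt_eqF// powRr1// ltW.
have l0 : 0 < l by rewrite powR_gt0.
have l1 : l <= 1.
  have : l ^+ n <= 1.
    rewrite ln ler_pdivrMr// mul1r.
    have : s * k <= s * (20 ^+ n * m) by rewrite ler_pM2l.
    have : s * 20 ^+ n * m <= 1 * m by rewrite ler_pM2r.
    by lra.
  by rewrite expr_le1// ?ltW//; exact: (leq_trans _ n5).
pose h := l * (b / 2).
have h0 : 0 < h by rewrite mulr_gt0.
have hb : h <= b / 2 by rewrite ger_pMl.
have vE : vol (lower h (cone_slab h)) = (s * k)%:E.
  rewrite cone_lower_homothet// vol_homothet//; last exact: measurable_lower.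
    by rewrite mE -EFinM /h mulfK ?gt_eqF// ln divfK ?gt_eqF.
  by rewrite divr_gt0.
exists (lower h (cone_slab h)).
have sk : 0 < s * k by rewrite mulr_gt0.
have [e e0 eE] := vol_real (@layer_sub h (cone_slab h)).
have [p pE pe] := vol_boundary_real h (cone_slab h).
have {}pe : p <= e by rewrite -lee_fin -eE.
have := cone_layer_vol h0 hb; rewrite vE eE -EFinD -EFinM lee_fin; set eta := _ / n%:R => H.
split.
- by apply: borel_closed; exact: closed_lower.
- exact: lower_sub.
- by rewrite EFin_div// mulfK// gt_eqF.
rewrite pE EFin_div// lee_fin ler_pdivrMr// (le_trans pe)//.
pose X : R := 6 * (1000 * dl).
have Xn : eta * n%:R = X by apply: divfK; rewrite gt_eqF.
have X0 : 0 < X by rewrite /X; lra.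
have X1 : X <= 1 / 2 by rewrite /X; lra.
have eta0 : 0 < eta by rewrite -(pmulr_lgt0 _ n0) Xn.
(* Here [(1 + eta)^n <= exp X <= 1 / (1 - X) <= 1 + 2 * X], the last because [X <= 1/2]. *)
have pX : (1 + eta) ^+ n <= 1 + 2 * X.
  apply: (@le_trans _ _ (expR X)).
    rewrite -Xn expRM_natr lerXn2r ?nnegrE ?expR_ge0//; first lra.
    exact: expR_ge1Dx.
  have := expR_ge1Dx (- X); rewrite expRN => eX.
  have eX0 := expR_gt0 X.
  have : (1 + - X) * expR X <= 1 by rewrite -ler_pdivlMr// div1r.
  by nra.
have : (1 + eta) ^+ n * (s * k) <= (1 + 2 * X) * (s * k) by rewrite ler_pM2r.
by rewrite /X in H *; lra.
Qed.

End body.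

Unset Implicit Arguments.
Set Strict Implicit.

Theorem theorem1p6 (R : realType) :
  exists C c c0 C' : R,
    [/\ 0 < C, 0 < c, 0 < c0 & 0 < C'] /\
    forall (n : nat) (Q : set 'rV[R]_n) (rho r : R),
      (5 <= n)%N -> convex_body Q -> unconditional Q ->
      0 < rho -> 0 < r -> C * r <= rho ->
      exists K : set 'rV[R]_n,
        [/\ convex_body K,
            exists v : 'rV[R]_n, homothet v r Q `<=` K,
            exists w : 'rV[R]_n, K `<=` homothet w rho Q,
            exists S : set 'rV[R]_n,
              [/\ borel S, S `<=` K,
                  (c0%:E <= vol S / vol K <= (1 / 2)%:E)%E &
                  (vol (l0_boundary K S) / vol S
                     <= (C' * r / (n%:R * rho))%:E)%E] &
            forall s : R, 0 < s -> s < expR (- (c * n%:R)) ->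
            exists S' : set 'rV[R]_n,
              [/\ borel S', S' `<=` K,
                  (vol S' / vol K = s%:E)%E &
                  (vol (l0_boundary K S') / vol S'
                     <= (C' * r / rho)%:E)%E]].
Proof.
(* With [dl = 5 * r / rho], the first constant gives [dl <= 5 / 10^6], within [dl_small]. The last
   is the 12 * 1000 of the small cuts times 5; the large cut needs only 25 * 1000. *)
exists (1000 * 1000), 19, (1 / 4), (60 * 1000); split; first by split; lra.
move=> n Q rho r n5 bQ uQ rho0 r0 Cr.
have [u [Qu u0 Qsub]] := unconditional_position bQ uQ.
(* The cylinder has cross-section [dl * b = r], and half the axis plus an offset is
   [rho / 2 + r <= rho]. *)
pose b := rho / 5; pose dl := r / b.
have b0 : 0 < b by rewrite divr_gt0.
have dl0 : 0 < dl by rewrite divr_gt0.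
have dlb : dl * b = r by rewrite /dl divfK// gt_eqF.
have dls : dl <= 1 / 1000 / 100 by rewrite /dl ler_pdivrMr// /b; lra.
have dlE : dl = 5 * r / rho.
  by rewrite /dl /b invf_div mulrCA mulrA.
exists (body Q u b dl); split.
- exact: convex_body_body.
- by exists ((3 * b) *: u); rewrite -dlb; exact: homothet_sub_body.
- exists ((5 / 2 * b) *: u); apply: body_sub_homothet => //.
  by rewrite dlb /b; lra.
- have [S [bS SK Sv Sb]] := exists_half n5 bQ uQ u0 Qsub b0 dl0 dls.
  exists S; split => //; apply: (le_trans Sb); rewrite lee_fin dlE.
  have n0 : 0 < n%:R :> R by rewrite ltr0n (leq_trans _ n5).
  have rr : 0 <= r / (n%:R * rho) by rewrite divr_ge0 ?mulr_ge0 ?ltW.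
  rewrite -mulrA (_ : 5 * (1000 * _ / _) = 25 * 1000 * (r / (n%:R * rho))); last first.
    by field; rewrite !lt0r_neq0.
  rewrite -mulrA; lra.
- move=> s s0 sn; have [S [bS SK Sv Sb]] := exists_small n5 bQ uQ u0 Qsub b0 dl0 dls s0 sn.
  exists S; split => //; apply: (le_trans Sb); rewrite lee_fin dlE.
  rewrite -!mulrA; lra.
Qed.
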